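(* For every constant integer $\alpha>1$, there is a polynomial-time $O\!\left(n^{1-\frac{1}{\alpha}}\cdot(\ln t)^{\frac{1}{\alpha}}\right)$-approximation algorithm for the SCT-$\alpha$ problem.
   Context: Set Cover with $\alpha$-Tuples (SCT-$\alpha$) problem: let $T$ be a set of $t$ targets, $V$ a set of $n$ elements, and $\alpha$ a positive integer constant greater than one. For every $\alpha$-tuple $P=\{v_1,\dots,v_\alpha\}\subseteq V$, $C(P)\subseteq T$ denotes the set of targets covered by $P$. The problem asks for a smallest subset $S\subseteq V$ such that $\bigcup_{\{v_1,\dots,v_\alpha\}\subseteq S} C(\{v_1,\dots,v_\alpha\})=T$. An $r$-approximation algorithm outputs a feasible solution of size at most $r$ times the optimum. *)

(* Defs.v *)
From mathcomp Require Import all_boot all_order all_algebra.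
From mathcomp Require Import reals exp.
Set Implicit Arguments.
Unset Strict Implicit.
Unset Printing Implicit Defensive.

(* Machine model: while-programs on a random access machine with finitely many
   used registers and an unbounded memory, both holding natural numbers. Every
   node of an evaluated expression and every command dispatch costs one time
   unit. The only arithmetic is addition and truncated subtraction: with
   unit-cost multiplication this time measure would not be polynomially related
   to that of Turing machines. *)

Inductive expr : Type :=
| Const of nat
| Reg of nat
| Fetch of expr
| Plus of expr & expr
| Minus of expr & expr.

Inductive cmd : Type :=
| Skip
| Assign of nat & expr
| Store of expr & expr
| Seq of cmd & cmd
| If of expr & cmd & cmd
| While of expr & cmd.

Record state : Type := State { reg : nat -> nat; heap : nat -> nat }.

Definition update (f : nat -> nat) (a v : nat) : nat -> nat :=
  fun b => if b == a then v else f b.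

Fixpoint eval (s : state) (e : expr) : nat :=
  match e with
  | Const c => c
  | Reg x => reg s x
  | Fetch e1 => heap s (eval s e1)
  | Plus e1 e2 => eval s e1 + eval s e2
  | Minus e1 e2 => eval s e1 - eval s e2
  end.

Fixpoint cost (e : expr) : nat :=
  match e with
  | Const _ | Reg _ => 1
  | Fetch e1 => (cost e1).+1
  | Plus e1 e2 | Minus e1 e2 => (cost e1 + cost e2).+1
  end.

(* [exec c s k s']: started in [s], [c] halts in [s'] after [k] time units.
   A guard holds when its value is nonzero. *)
Inductive exec : cmd -> state -> nat -> state -> Prop :=
| ExecSkip s : exec Skip s 1 s
| ExecAssign s x e :
    exec (Assign x e) s (cost e).+1
      (State (update (reg s) x (eval s e)) (heap s))
| ExecStore s e1 e2 :
    exec (Store e1 e2) s (cost e1 + cost e2).+1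
      (State (reg s) (update (heap s) (eval s e1) (eval s e2)))
| ExecSeq c1 c2 s1 s2 s3 k1 k2 :
    exec c1 s1 k1 s2 -> exec c2 s2 k2 s3 -> exec (Seq c1 c2) s1 (k1 + k2) s3
| ExecIfTrue e c1 c2 s s' k :
    eval s e != 0 -> exec c1 s k s' -> exec (If e c1 c2) s ((cost e).+1 + k) s'
| ExecIfFalse e c1 c2 s s' k :
    eval s e = 0 -> exec c2 s k s' -> exec (If e c1 c2) s ((cost e).+1 + k) s'
| ExecWhileTrue e c s1 s2 s3 k1 k2 :
    eval s1 e != 0 -> exec c s1 k1 s2 -> exec (While e c) s2 k2 s3 ->
    exec (While e c) s1 ((cost e).+1 + k1 + k2) s3
| ExecWhileFalse e c s :
    eval s e = 0 -> exec (While e c) s (cost e).+1 s.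

Lemma exec_deterministic c s k1 s1 k2 s2 :
  exec c s k1 s1 -> exec c s k2 s2 -> k1 = k2 /\ s1 = s2.
Proof.
move=> H; elim: H k2 s2 => {c s k1 s1}.
- by move=> s k2 s2 H; inversion H.
- by move=> s x e k2 s2 H; inversion H.
- by move=> s e1 e2 k2 s2 H; inversion H.
- move=> c1 c2 s1 s2 s3 k1 k2 _ IH1 _ IH2 k' s' H.
  inversion H as [| | |? ? ? s2' ? k1' k2' E1 E2| | | |]; subst.
  by have [-> E] := IH1 _ _ E1; subst; have [-> ->] := IH2 _ _ E2.
- move=> e c1 c2 s s' k He _ IH k' s'' H.
  inversion H as [| | | |? ? ? ? ? k2 G E|? ? ? ? ? k2 G E| |]; subst.
    by have [-> ->] := IH _ _ E.
  by rewrite G in He.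
- move=> e c1 c2 s s' k He _ IH k' s'' H.
  inversion H as [| | | |? ? ? ? ? k2 G E|? ? ? ? ? k2 G E| |]; subst.
    by rewrite He in G.
  by have [-> ->] := IH _ _ E.
- move=> e c s1 s2 s3 k1 k2 He _ IH1 _ IH2 k' s' H.
  inversion H as [| | | | | |? ? ? s2' ? k1' k2' G E1 E2|? ? ? G]; subst.
    by have [-> E] := IH1 _ _ E1; subst; have [-> ->] := IH2 _ _ E2.
  by rewrite G in He.
- move=> e c s He k' s' H.
  inversion H as [| | | | | |? ? ? s2' ? k1' k2' G E1 E2|? ? ? G]; subst => //.
  by rewrite He in G.
Qed.

(* A bit string is given in memory from address 0 on, one bit per cell, with its
   length in register 0; everything else is 0. Outputs use the same format,
   except that the rest of the final state is arbitrary. *)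
Definition initial (w : seq bool) : state :=
  State (fun x => if x == 0 then size w else 0)
        (fun a => nat_of_bool (nth false w a)).

Definition holds_output (s : state) (w : seq bool) : Prop :=
  reg s 0 = size w /\ forall a, a < size w -> heap s a = nth false w a.

Definition outputs (p : cmd) (w w' : seq bool) : Prop :=
  exists k s, exec p (initial w) k s /\ holds_output s w'.

Definition halts_within (p : cmd) (w : seq bool) (b : nat) : Prop :=
  exists k s, exec p (initial w) k s /\ k <= b.

Definition polytime_on (D : seq bool -> Prop) (p : cmd) : Prop :=
  exists a d : nat, forall w, D w -> halts_within p w (a * size w ^ d + a).

(* An instance with n elements, t targets and covering function C. *)
Definition sct (alpha n t : nat) : Type :=
  {P : {set 'I_n} | #|P| == alpha} -> {set 'I_t}.

Definition feasible (alpha n t : nat) (C : sct alpha n t) (S : {set 'I_n}) :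
    Prop :=
  \bigcup_(P : {P : {set 'I_n} | #|P| == alpha} | val P \subset S) C P
    = [set: 'I_t].

Definition optimal (alpha n t : nat) (C : sct alpha n t) (S : {set 'I_n}) :
    Prop :=
  feasible C S /\ forall S' : {set 'I_n}, feasible C S' -> #|S| <= #|S'|.

Definition bits_of_set (n : nat) (A : {set 'I_n}) : seq bool :=
  [seq i \in A | i <- enum 'I_n].

(* n and t in unary, each closed by a 0, then the table of C: for each
   alpha-tuple P the characteristic vector of P followed by that of C P. *)
Definition encode (alpha n t : nat) (C : sct alpha n t) : seq bool :=
  nseq n true ++ false :: nseq t true ++ false ::
  flatten [seq bits_of_set (val P) ++ bits_of_set (C P)
          | P <- enum {: {P : {set 'I_n} | #|P| == alpha}}].

Definition sct_encoding (alpha : nat) (w : seq bool) : Prop :=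
  exists (n t : nat) (C : sct alpha n t), w = encode C.

Local Open Scope ring_scope.

(* The guarantee concerns instances that have a feasible solution; for the
   others there is no optimum. *)
Definition sct_approximates (R : realType) (alpha : nat) (p : cmd)
    (r : nat -> nat -> R) : Prop :=
  forall (n t : nat) (C : sct alpha n t),
    (exists S0 : {set 'I_n}, feasible C S0) ->
    exists S : {set 'I_n},
      [/\ outputs p (encode C) (bits_of_set S),
          feasible C S &
          forall Sopt : {set 'I_n}, optimal C Sopt ->
            #|S|%:R <= r n t * #|Sopt|%:R].

(* Main.v *)
Require Import Defs.
From mathcomp Require Import all_boot all_order all_algebra.
From mathcomp Require Import reals sequences exp.
From mathcomp Require Import zify lra.

(* Run the greedy set cover algorithm with the alpha-tuples as the covering
   sets, and return the union S of the tuples it picks. If an optimal solution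
   has k elements, it contains m <= k^alpha tuples, which together cover all
   targets. Hence each pick shrinks the number of uncovered targets by a factor
   1 - 1/m, the greedy algorithm makes at most m ln t + 1 picks, and |S| is
   O(k^alpha ln t). Also |S| <= n. The weighted geometric mean of these two
   bounds, with weights 1/alpha and 1 - 1/alpha, is
   O(n^(1 - 1/alpha) (ln t)^(1/alpha)) k. *)

Set Implicit Arguments.
Unset Strict Implicit.
Unset Printing Implicit Defensive.

(** * Time-bounded total-correctness rules for while-programs *)

(** Since [exec] is deterministic, exhibiting one terminating execution amounts to a
    total-correctness triple with a time bound. *)
Definition runs (c : cmd) (s : state) (b : nat) (Q : state -> Prop) : Prop :=
  exists k s', [/\ exec c s k s', k <= b & Q s'].

Lemma runs_weaken c s b b' (Q Q' : state -> Prop) :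
  b <= b' -> (forall s', Q s' -> Q' s') -> runs c s b Q -> runs c s b' Q'.
Proof.
move=> hb hQ [k [s' [E hk hs]]]; exists k, s'; split=> //; last exact: hQ.
exact: leq_trans hb.
Qed.

Lemma runs_le c s b b' (Q : state -> Prop) :
  b <= b' -> runs c s b Q -> runs c s b' Q.
Proof. by move=> hb; apply: runs_weaken. Qed.

Lemma runs_seq c1 c2 s b1 b2 Q :
  runs c1 s b1 (fun s1 => runs c2 s1 b2 Q) -> runs (Seq c1 c2) s (b1 + b2) Q.
Proof.
move=> [k1 [s1 [E1 h1 [k2 [s2 [E2 h2 hQ]]]]]]; exists (k1 + k2), s2.
by split=> //; [exact: ExecSeq E1 E2 | exact: leq_add].
Qed.

Lemma runs_assign x e s (Q : state -> Prop) :
  Q (State (update (reg s) x (eval s e)) (heap s)) ->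
  runs (Assign x e) s (cost e).+1 Q.
Proof.
by move=> hQ; do 2!eexists; split; [exact: ExecAssign | | exact: hQ].
Qed.

Lemma runs_store e1 e2 s (Q : state -> Prop) :
  Q (State (reg s) (update (heap s) (eval s e1) (eval s e2))) ->
  runs (Store e1 e2) s (cost e1 + cost e2).+1 Q.
Proof.
by move=> hQ; do 2!eexists; split; [exact: ExecStore | | exact: hQ].
Qed.

(** The budget [b.+1] is at least the unit cost of [Skip], so one bound serves both branches. *)
Lemma runs_when e c s b (Q : state -> Prop) :
  (eval s e != 0 -> runs c s b.+1 Q) -> (eval s e = 0 -> Q s) ->
  runs (If e c Skip) s ((cost e).+1 + b.+1) Q.
Proof.
case: (eqVneq (eval s e) 0) => [e0 _ hQ | e1 /(_ isT) [k [s' [E hk hQ]]] _].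
  exists ((cost e).+1 + 1), s; split; [| by rewrite leq_add2l | exact: hQ].
  by apply: ExecIfFalse => //; exact: ExecSkip.
exists ((cost e).+1 + k), s'; split=> //; last by rewrite leq_add2l.
exact: ExecIfTrue.
Qed.

(** The invariant is indexed by the iteration number and decides the guard, so the loop body runs
    exactly [m] times; induction on the number [d] of remaining iterations. *)
Lemma runs_for e c b m (I : nat -> state -> Prop) s :
  (forall i s, i < m -> I i s -> eval s e != 0 /\ runs c s b (I i.+1)) ->
  (forall s, I m s -> eval s e = 0) ->
  I 0 s -> runs (While e c) s (m * ((cost e).+1 + b) + (cost e).+1) (I m).
Proof.
move=> hbody hend hI.
suff H d i s0 : i + d = m -> I i s0 ->
    runs (While e c) s0 (d * ((cost e).+1 + b) + (cost e).+1) (I m).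
  exact: (H m 0).
elim: d i s0 => [|d IH] i s0 hid hi.
  have im : i = m by lia.
  subst i; exists (cost e).+1, s0; split=> //.
  by apply: ExecWhileFalse; exact: hend.
have [|he [k1 [s1 [E1 h1 hi1]]]] := hbody i s0 _ hi; first by lia.
have [|k2 [s2 [E2 h2 hm]]] := IH i.+1 s1 _ hi1; first by lia.
exists ((cost e).+1 + k1 + k2), s2; split=> //.
  exact: ExecWhileTrue E1 E2.
by rewrite mulSn; lia.
Qed.

(** * The greedy program *)

(* Registers: 0 = input length N, 1 = n, 2 = t, 3 = rounds left, 4 = best gain,
   5 = address of the best row, 6 = address of the current row, 7 = its gain,
   8 = offset in a row. The work area, addresses N to N + n + t - 1, has the
   format of a table row: chosen elements, then covered targets. *)
Definition gain_cmd : cmd :=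
  Seq (Assign 7 (Const 0)) (Seq (Assign 8 (Reg 1))
  (While (Minus (Plus (Reg 1) (Reg 2)) (Reg 8))
    (Seq (Assign 7 (Plus (Reg 7)
            (Minus (Fetch (Plus (Reg 6) (Reg 8)))
                   (Fetch (Plus (Reg 0) (Reg 8))))))
         (Assign 8 (Plus (Reg 8) (Const 1)))))).

Definition best_cmd : cmd :=
  Seq (Assign 4 (Const 0)) (Seq (Assign 5 (Reg 0))
  (Seq (Assign 6 (Plus (Plus (Reg 1) (Reg 2)) (Const 2)))
  (While (Minus (Reg 0) (Reg 6))
    (Seq gain_cmd
    (Seq (If (Minus (Reg 7) (Reg 4))
             (Seq (Assign 4 (Reg 7)) (Assign 5 (Reg 6))) Skip)
         (Assign 6 (Plus (Reg 6) (Plus (Reg 1) (Reg 2))))))))).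

Definition merge_cmd : cmd :=
  Seq (Assign 8 (Const 0))
  (While (Minus (Plus (Reg 1) (Reg 2)) (Reg 8))
    (Seq (Store (Plus (Reg 0) (Reg 8))
            (Plus (Fetch (Plus (Reg 0) (Reg 8)))
               (Minus (Fetch (Plus (Reg 5) (Reg 8)))
                      (Fetch (Plus (Reg 0) (Reg 8))))))
         (Assign 8 (Plus (Reg 8) (Const 1))))).

Definition parse_cmd : cmd :=
  Seq (While (Fetch (Reg 1)) (Assign 1 (Plus (Reg 1) (Const 1))))
  (Seq (While (Fetch (Plus (Plus (Reg 1) (Const 1)) (Reg 2)))
          (Assign 2 (Plus (Reg 2) (Const 1))))
       (Assign 3 (Reg 2))).

Definition copy_cmd : cmd :=
  Seq (Assign 8 (Const 0))
  (Seq (While (Minus (Reg 1) (Reg 8))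
         (Seq (Store (Reg 8) (Fetch (Plus (Reg 0) (Reg 8))))
              (Assign 8 (Plus (Reg 8) (Const 1)))))
       (Assign 0 (Reg 1))).

Definition greedy_cmd : cmd :=
  Seq parse_cmd
  (Seq (While (Reg 3)
         (Seq (Assign 3 (Minus (Reg 3) (Const 1))) (Seq best_cmd merge_cmd)))
       copy_cmd).

(** * Correctness and running time of the subroutines *)

(** On bits, truncated subtraction is set difference, and the offsets from [n] on form the target
    part of a row. On a table row this counts the newly covered targets. *)
Definition gain (h : nat -> nat) (N n t p : nat) : nat :=
  \sum_(n <= j < n + t) (h (p + j) - h (N + j)).

Definition agree_off (X : pred nat) (s s' : state) : Prop :=
  forall x, ~~ X x -> reg s' x = reg s x.

Lemma gain_cmd_runs N n t s :
  reg s 0 = N -> reg s 1 = n -> reg s 2 = t ->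
  runs gain_cmd s (22 * t + 11)
    (fun s' => [/\ heap s' = heap s, reg s' 7 = gain (heap s) N n t (reg s 6) &
                   agree_off (pred2 7 8) s s']).
Proof.
move=> r0 r1 r2; rewrite /gain_cmd.
pose I i s' := [/\ heap s' = heap s,
   reg s' 7 = \sum_(n <= j < n + i) (heap s (reg s 6 + j) - heap s (N + j)),
   reg s' 8 = n + i & agree_off (pred2 7 8) s s'].
(* The summands follow the shape of the command: 2 for each initial assignment, 6 for each test of
   the guard, 16 for the loop body. *)
apply: (@runs_le _ _ (2 + (2 + (t * (6 + 16) + 6)))); first by lia.
apply: runs_seq; apply: (runs_assign (e := Const 0)).
apply: runs_seq; apply: (runs_assign (e := Reg 1)).
apply: runs_weaken (leqnn _) _ (@runs_for _ _ 16 t I _ _ _ _).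
- by move=> s' [h1 h2 h3 h4]; split.
- move=> i s' lt_it [h1 h2 h3 h4]; split.
    by rewrite /= (h4 1) ?(h4 2) // r1 r2 h3; lia.
  apply: (runs_seq (b1 := 12) (b2 := 4)).
  apply: runs_assign; apply: runs_assign.
  split; rewrite //=.
  + rewrite /update /= h1 h2 h3 (h4 0) ?(h4 6) // r0 addnS big_nat_recr //=.
    lia.
  + by rewrite /update /= h3; lia.
  + move=> x hx; have /norP[x7 x8] := hx.
    by rewrite /update /= (negPf x7) (negPf x8) h4.
- by move=> s' [h1 h2 h3 h4] /=; rewrite (h4 1) ?(h4 2) // r1 r2 h3; lia.
- split=> //=; rewrite ?/update //=.
  + by rewrite addn0 big_geq.
  + by rewrite r1 addn0.
  + by move=> x /norP[x7 x8] /=; rewrite (negPf x7) (negPf x8).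
Qed.

(* If no row has positive gain, the best row is by convention the work area
   itself, so that merging it is a no-op. *)
Definition best_row (h : nat -> nat) (N n t M p : nat) : Prop :=
  let row q := n + t + 2 + q * (n + t) in
  (p = N /\ forall q, q < M -> gain h N n t (row q) = 0) \/
  exists q, [/\ q < M, p = row q, 0 < gain h N n t p &
    forall q', q' < M -> gain h N n t (row q') <= gain h N n t p].

(** If there are rows, their width [n + t] must be positive: otherwise the row pointer would equal
    [N] from the start and the scan would stop at once. *)
Lemma best_cmd_runs N n t M s :
  reg s 0 = N -> reg s 1 = n -> reg s 2 = t ->
  N = n + t + 2 + M * (n + t) -> (0 < M -> 0 < n + t) ->
  runs best_cmd s (M * (22 * t + 29) + 14)
    (fun s' => [/\ heap s' = heap s, best_row (heap s) N n t M (reg s' 5) &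
                   agree_off (fun x => 4 <= x <= 8) s s']).
Proof.
move=> r0 r1 r2 hN hM; rewrite /best_cmd.
pose row q := n + t + 2 + q * (n + t).
pose I i s' := [/\ heap s' = heap s, reg s' 6 = row i,
   (reg s' 4 = 0 /\ reg s' 5 = N) \/
     (exists q, [/\ q < i, reg s' 5 = row q, 0 < reg s' 4 &
                    reg s' 4 = gain (heap s) N n t (row q)]),
   forall q, q < i -> gain (heap s) N n t (row q) <= reg s' 4 &
   agree_off (fun x => 4 <= x <= 8) s s'].
apply: (@runs_le _ _
    (2 + (2 + (6 + (M * (4 + (22 * t + 11 + (8 + 6))) + 4))))); first by lia.
apply: runs_seq; apply: (runs_assign (e := Const 0)).
apply: runs_seq; apply: (runs_assign (e := Reg 0)).
apply: runs_seq; apply: runs_assign.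
apply: runs_weaken (leqnn _) _
  (@runs_for _ _ (22 * t + 11 + (8 + 6)) M I _ _ _ _).
- move=> s' [h1 h2 h3 h4 h5]; split=> //.
  case: h3 => [[e4 e5]|[q [lt_q e5 g0 e4]]];
    [left; split=> // q lt_q | right; exists q].
    by have := h4 _ lt_q; rewrite e4 leqn0 => /eqP.
  by rewrite e5 -e4; split.
- move=> i s' lt_i [h1 h2 h3 h4 h5]; split.
    rewrite /= h5 // r0 h2 hN /row -lt0n.
    by have := hM (leq_ltn_trans (leq0n _) lt_i); nia.
  apply: runs_seq.
  apply: runs_weaken (leqnn _) _ (@gain_cmd_runs N n t s' _ _ _);
    [| by rewrite h5 | by rewrite h5 | by rewrite h5].
  move=> s1 [k1 k2 k3].
  have {}k5 : agree_off (fun x => 4 <= x <= 8) s s1.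
    by move=> x hx; rewrite k3 ?h5 //=; lia.
  have e4 : reg s1 4 = reg s' 4 by rewrite k3.
  have e5 : reg s1 5 = reg s' 5 by rewrite k3.
  have e6 : reg s1 6 = reg s' 6 by rewrite k3.
  rewrite h1 in k1 k2; rewrite h2 in k2.
  (* Only a strictly larger gain replaces the current best, so register 5 keeps its default [N]
     until a row of positive gain appears. *)
  apply: runs_seq; apply: (@runs_when _ _ _ 3).
    rewrite /= => gt74; apply: (runs_seq (b1 := 2) (b2 := 2)).
    apply: (runs_assign (e := Reg 7)); apply: (runs_assign (e := Reg 6)).
    apply: runs_assign.
    split; rewrite /update /=; rewrite ?k1 //.
    + by rewrite e6 h2 (k5 1) ?(k5 2) // r1 r2 /row mulSn; lia.
    + by right; exists i; split=> //; [congruence | lia].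
    + move=> q; rewrite ltnS leq_eqVlt => /predU1P[->|/h4]; [by rewrite k2|lia].
    + by move=> x hx /=; rewrite !ifN ?k5 //; apply/eqP; lia.
  rewrite /= => le74; apply: runs_assign.
  split; rewrite /update /=; rewrite ?k1 //.
  + by rewrite e6 h2 (k5 1) ?(k5 2) // r1 r2 /row mulSn; lia.
  + case: h3 => [[? ?]|[q [? ? ? ?]]]; [by left; split; congruence|].
    by right; exists q; split; [lia|congruence|lia|congruence].
  + move=> q; rewrite ltnS leq_eqVlt => /predU1P[->|/h4]; lia.
  + by move=> x hx /=; rewrite !ifN ?k5 //; apply/eqP; lia.
- by move=> s' [h1 h2 h3 h4 h5] /=; rewrite h5 // r0 h2 hN /row; lia.
- split=> //=; rewrite /update //=.
  + by rewrite r1 r2 /row; lia.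
  + by left.
  + by move=> x hx /=; rewrite !ifN //; apply/eqP; lia.
Qed.

(** With truncated subtraction [a + (b - a)] is the maximum, which on bits is the union. The source
    row either is the work area or ends before it, so no cell is overwritten before it is read. *)
Lemma merge_cmd_runs N n t p s :
  reg s 0 = N -> reg s 1 = n -> reg s 2 = t -> reg s 5 = p ->
  p = N \/ p + (n + t) <= N ->
  runs merge_cmd s ((n + t) * 28 + 8)
    (fun s' => [/\ forall a, a < N -> heap s' a = heap s a,
                   forall j, j < n + t -> heap s' (N + j) =
                     heap s (N + j) + (heap s (p + j) - heap s (N + j)) &
                   agree_off (pred1 8) s s']).
Proof.
move=> r0 r1 r2 r5 hp; rewrite /merge_cmd.
pose I i s' := [/\
   forall a, a < N \/ N + i <= a -> heap s' a = heap s a,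
   forall j, j < i -> heap s' (N + j) =
     heap s (N + j) + (heap s (p + j) - heap s (N + j)),
   reg s' 8 = i &
   agree_off (pred1 8) s s'].
apply: (@runs_le _ _ (2 + ((n + t) * (6 + 22) + 6))); first by lia.
apply: runs_seq; apply: (runs_assign (e := Const 0)).
apply: runs_weaken (leqnn _) _ (@runs_for _ _ 22 (n + t) I _ _ _ _).
- by move=> s' [h1 h2 h3 h4]; split=> // a lt_a; apply: h1; left.
- move=> i s' lt_i [h1 h2 h3 h4]; split.
    by rewrite /= (h4 1) ?(h4 2) // r1 r2 h3; lia.
  apply: (runs_seq (b1 := 18) (b2 := 4)); apply: runs_store; apply: runs_assign.
  split; rewrite /update /= ?h3 ?(h4 0) ?(h4 5) // ?r0 ?r5.
  + by move=> a ha; rewrite ifN ?h1 //; [lia | apply/eqP; lia].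
  + move=> j; rewrite ltnS leq_eqVlt => /predU1P[->|lt_ji].
      by rewrite eqxx !h1 //; lia.
    by rewrite eqn_add2l ltn_eqF // h2.
  + lia.
  + by move=> x /= hx; rewrite ifN // h4.
- by move=> s' [h1 h2 h3 h4] /=; rewrite (h4 1) ?(h4 2) // r1 r2 h3; lia.
- by split=> //= x /= hx; rewrite /update ifN.
Qed.

(** The result is moved over the input; as [n <= N], the destination lies below the source and the
    two never overlap. *)
Lemma copy_cmd_runs N n s :
  reg s 0 = N -> reg s 1 = n -> n <= N ->
  runs copy_cmd s (n * 14 + 8)
    (fun s' => reg s' 0 = n /\ forall j, j < n -> heap s' j = heap s (N + j)).
Proof.
move=> r0 r1 hn; rewrite /copy_cmd.
pose I i s' := [/\
   forall a, N <= a -> heap s' a = heap s a,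
   forall j, j < i -> heap s' j = heap s (N + j),
   reg s' 8 = i &
   agree_off (pred1 8) s s'].
apply: (@runs_le _ _ (2 + (n * (4 + 10) + 4 + 2))); first by lia.
apply: runs_seq; apply: (runs_assign (e := Const 0)); apply: runs_seq.
apply: runs_weaken (leqnn _) _ (@runs_for _ _ 10 n I _ _ _ _).
- move=> s' [h1 h2 h3 h4]; apply: (runs_assign (e := Reg 1)).
  by rewrite /update /= h4.
- move=> i s' lt_i [h1 h2 h3 h4]; split.
    by rewrite /= (h4 1) // r1 h3; lia.
  apply: (runs_seq (b1 := 6) (b2 := 4)); apply: runs_store; apply: runs_assign.
  split; rewrite /update /= ?h3 ?(h4 0) // ?r0.
  + by move=> a ha; rewrite ifN ?h1 //; apply/eqP; lia.
  + move=> j; rewrite ltnS leq_eqVlt => /predU1P[->|lt_ji].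
      by rewrite eqxx !h1 //; lia.
    by rewrite ltn_eqF // h2.
  + lia.
  + by move=> x /= hx; rewrite ifN // h4.
- by move=> s' [h1 h2 h3 h4] /=; rewrite (h4 1) // r1 h3; lia.
- by split=> //= x /= hx; rewrite /update ifN.
Qed.

Lemma parse_cmd_runs n t s :
  (forall i, i < n -> heap s i != 0) -> heap s n = 0 ->
  (forall i, i < t -> heap s (n.+1 + i) != 0) -> heap s (n.+1 + t) = 0 ->
  reg s 1 = 0 -> reg s 2 = 0 ->
  runs parse_cmd s (n * 7 + t * 11 + 12)
    (fun s' => [/\ reg s' 0 = reg s 0, reg s' 1 = n, reg s' 2 = t,
                   reg s' 3 = t & heap s' = heap s]).
Proof.
move=> hn hn0 ht ht0 r1 r2.
apply: (@runs_le _ _ ((n * (3 + 4) + 3) + ((t * (7 + 4) + 7) + 2))).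
  by lia.
pose I i s' :=
  [/\ reg s' 0 = reg s 0, reg s' 1 = i, reg s' 2 = 0 & heap s' = heap s].
apply: runs_seq.
apply: runs_weaken (leqnn _) _ (@runs_for _ _ 4 n I _ _ _ _) => //.
- move=> s1 [k0 k1 k2 k3].
  pose J i s' :=
    [/\ reg s' 0 = reg s 0, reg s' 1 = n, reg s' 2 = i & heap s' = heap s].
  apply: runs_seq.
  apply: runs_weaken (leqnn _) _ (@runs_for _ _ 4 t J _ _ _ _) => //.
  + by move=> s2 [l0 l1 l2 l3]; apply: (runs_assign (e := Reg 2)); split.
  + move=> i s' lt_i [l0 l1 l2 l3] /=; rewrite l1 l2 l3 addn1 ht //; split=> //.
    by apply: runs_assign; split=> //; rewrite /update /= l2 addn1.
  + by move=> s' [l0 l1 l2 l3] /=; rewrite l1 l2 l3 addn1.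
- move=> i s' lt_i [l0 l1 l2 l3] /=; rewrite l1 l3 hn //; split=> //.
  by apply: runs_assign; split=> //; rewrite /update /= l1 addn1.
- by move=> s' [l0 l1 l2 l3] /=; rewrite l1 l3.
Qed.

(** * The abstract greedy algorithm and its feasibility *)

(* [greedy_reach C j S X]: some run of the greedy algorithm has, after [j]
   rounds, chosen the elements [S] and covered the targets [X]. *)
Inductive greedy_reach (alpha n t : nat) (C : sct alpha n t) :
    nat -> {set 'I_n} -> {set 'I_t} -> Prop :=
| GreedyStart : greedy_reach C 0 set0 set0
| GreedyStuck j S X :
    greedy_reach C j S X -> (forall P, C P \subset X) -> greedy_reach C j.+1 S X
| GreedyPick j S X P :
    greedy_reach C j S X -> 0 < #|C P :\: X| ->
    (forall P', #|C P' :\: X| <= #|C P :\: X|) ->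
    greedy_reach C j.+1 (val P :|: S) (C P :|: X).

Lemma feasibleP alpha n t (C : sct alpha n t) (S : {set 'I_n}) :
  feasible C S <-> 
    forall x, exists2 P : {P : {set 'I_n} | #|P| == alpha},
      val P \subset S & x \in C P.
Proof.
split=> [/setP hS x | hS].
  by have := hS x; rewrite inE => /bigcupP[P hP hx]; exists P.
by apply/setP=> x; rewrite inE; have [P hP hx] := hS x; apply/bigcupP; exists P.
Qed.

Lemma greedy_reach_covered alpha n t (C : sct alpha n t) j S X :
  greedy_reach C j S X ->
  forall x, x \in X -> exists2 P : {P : {set 'I_n} | #|P| == alpha},
    val P \subset S & x \in C P.
Proof.
elim=> [x|//|j' S' X' P _ IH _ _ x]; rewrite !inE //.
case/orP=> [hx|/IH[P' hP' hx]]; first by exists P => //; apply: subsetUl.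
by exists P' => //; apply: subset_trans hP' (subsetUr _ _).
Qed.

Lemma cardsU_diff (T : finType) (A B : {set T}) :
  #|A :|: B| = #|A :\: B| + #|B|.
Proof. by rewrite cardsU cardsD -addnBAC // subset_leq_card ?subsetIl. Qed.

(** A stuck round means that no tuple covers anything new, hence by feasibility that all is covered;
    every other round covers a new target. Thus [t] rounds suffice. *)
Lemma greedy_reach_progress alpha n t (C : sct alpha n t) S0 j S X :
  feasible C S0 -> greedy_reach C j S X -> X = setT \/ j <= #|X|.
Proof.
move=> /feasibleP hS0; elim=> [|j' S' X' _ _ hall|j' S' X' P _ IH gt0 _].
- by right.
- left; apply/setP=> x; rewrite inE; have [P _ hx] := hS0 x.
  exact: (subsetP (hall P)).
- case: IH => [->|le_j]; first by left; rewrite setUT.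
  by right; rewrite cardsU_diff -add1n leq_add.
Qed.

Lemma greedy_reach_feasible alpha n t (C : sct alpha n t) S0 S X :
  feasible C S0 -> greedy_reach C t S X -> feasible C S.
Proof.
move=> hS0 hr; apply/feasibleP => x; apply: (greedy_reach_covered hr).
case: (greedy_reach_progress hS0 hr) => [->|le_t]; first by rewrite inE.
suff -> : X = setT by rewrite inE.
by apply/eqP; rewrite eqEcard subsetT cardsT card_ord.
Qed.

(** * Counting tuples and the decay of the uncovered targets *)

Definition tuples_in (alpha n : nat) (S : {set 'I_n}) : nat :=
  #|[set P : {P : {set 'I_n} | #|P| == alpha} | val P \subset S]|.

Lemma binomial_le_expn k a : 'C(k, a) <= k ^ a.
Proof.
apply: (@leq_trans (k ^_ a)).
  by rewrite -bin_ffact leq_pmulr ?fact_gt0.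
elim: a => [|a IH]; rewrite ?ffactn0 // ffactnSr expnSr.
by rewrite leq_mul ?leq_subr.
Qed.

(** The tuples inside [S] are its subsets of size [alpha], counted by a binomial coefficient. *)
Lemma tuples_in_le alpha n (S : {set 'I_n}) : tuples_in alpha S <= #|S| ^ alpha.
Proof.
apply: leq_trans (binomial_le_expn _ _); rewrite -cards_draws /tuples_in.
rewrite -(card_imset _ val_inj); apply/subset_leq_card/subsetP => A.
case/imsetP=> P; rewrite !inE => hP ->; rewrite hP; exact: (valP P).
Qed.

(* The tuples inside a feasible set cover what is left, so one of them covers at
   least the average share. *)
Lemma uncovered_le_gain alpha n t (C : sct alpha n t) S0 (X : {set 'I_t}) g :
  feasible C S0 -> (forall P, #|C P :\: X| <= g) ->
  #|~: X| <= tuples_in alpha S0 * g.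
Proof.
move=> /feasibleP hS0 hg.
have sub : ~: X \subset
    \bigcup_(P : {P : {set 'I_n} | #|P| == alpha} | val P \subset S0)
      (C P :\: X).
  apply/subsetP=> x; rewrite inE => hx; have [P hP hxP] := hS0 x.
  by apply/bigcupP; exists P => //; rewrite inE hx.
apply: leq_trans (subset_leq_card sub) _.
rewrite /tuples_in -sum_nat_const big_mkcond [leqRHS]big_mkcond /=.
elim/big_rec2: _ => [|P m B _ IH]; first by rewrite cards0.
rewrite inE; case: ifP => _; last by rewrite set0U.
by apply: leq_trans (leq_add (hg P) IH); rewrite leq_card_setU.
Qed.

(* With m tuples in a feasible set, each pick shrinks the number of uncovered
   targets by the factor 1 - 1/m. *)
Lemma greedy_reach_decay alpha n t (C : sct alpha n t) S0 j S X :
  feasible C S0 -> greedy_reach C j S X ->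
  let m := tuples_in alpha S0 in
  exists g, [/\ #|S| <= alpha * g, #|~: X| * m ^ g <= t * m.-1 ^ g &
                0 < g -> 0 < m /\ m ^ g.-1 <= t * m.-1 ^ g.-1].
Proof.
move=> hS0 hr /=; set m := tuples_in _ _.
(* [g] counts the actual picks, not the rounds [j]; a stuck round leaves it unchanged. *)
elim: hr => [|//|j' S' X' P _ [g [hS hX _]] gt0 hmax].
  exists 0; split=> //; first by rewrite cards0.
  by rewrite setC0 cardsT card_ord.
have := uncovered_le_gain hS0 hmax; rewrite -/m => hu.
have hsplit : #|~: X'| = #|C P :\: X'| + #|~: (C P :|: X')|.
  rewrite -(cardsID (C P) (~: X')); congr addn; apply: eq_card => x;
    by rewrite !inE; do 2!case: (_ \in _).
exists g.+1; split.
- rewrite mulnS; apply: leq_trans (leq_add (eq_leq (eqP (valP P))) hS).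
  by rewrite leq_card_setU.
(* The pick removes its gain from the uncovered targets, and [m] times that gain is at least their
   former number. *)
- have hu' : #|~: (C P :|: X')| * m <= #|~: X'| * m.-1 by nia.
  rewrite expnSr mulnA mulnAC expnSr mulnA.
  apply: leq_trans (leq_mul hX (leqnn _)).
  by rewrite [leqRHS]mulnAC leq_mul.
- move=> _ /=; split; first by nia.
  apply: leq_trans hX; by rewrite leq_pmull // hsplit addn_gt0 gt0.
Qed.

(** * Layout of the encoded instance *)

Lemma size_bits_of_set n (A : {set 'I_n}) : size (bits_of_set A) = n.
Proof. by rewrite size_map size_enum_ord. Qed.

Lemma nth_bits_of_set n (A : {set 'I_n}) (i : 'I_n) :
  nth false (bits_of_set A) i = (i \in A).
Proof. by rewrite (nth_map i) ?size_enum_ord // nth_ord_enum. Qed.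

Lemma nth_flatten_uniform (T : Type) (x : T) (ss : seq (seq T)) d q j :
  all (fun s => size s == d) ss -> q < size ss -> j < d ->
  nth x (flatten ss) (q * d + j) = nth x (nth [::] ss q) j.
Proof.
elim: ss q => [|s ss IH] [|q] //= /andP[/eqP hs hss] lt_q lt_j;
  rewrite nth_cat hs.
  by rewrite mul0n lt_j.
rewrite ifN; last by rewrite mulSn; lia.
by rewrite (_ : q.+1 * d + j - d = q * d + j) ?IH // mulSn; lia.
Qed.

Lemma size_flatten_uniform (T : Type) (ss : seq (seq T)) d :
  all (fun s => size s == d) ss -> size (flatten ss) = size ss * d.
Proof.
elim: ss => //= s ss IH /andP[/eqP hs /IH hss].
by rewrite size_cat hs hss mulSn.
Qed.

Definition row_bits n t (A : {set 'I_n}) (B : {set 'I_t}) : seq bool :=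
  bits_of_set A ++ bits_of_set B.

Lemma nth_row_bitsl n t (A : {set 'I_n}) (B : {set 'I_t}) (i : 'I_n) :
  nth false (row_bits A B) i = (i \in A).
Proof. by rewrite nth_cat size_bits_of_set ltn_ord nth_bits_of_set. Qed.

Lemma nth_row_bitsr n t (A : {set 'I_n}) (B : {set 'I_t}) (i : 'I_t) :
  nth false (row_bits A B) (n + i) = (i \in B).
Proof.
by rewrite nth_cat size_bits_of_set ltnNge leq_addr addKn nth_bits_of_set.
Qed.

Lemma row_bits_index n t j : j < n + t ->
  (exists i : 'I_n, j = i) \/ (exists i : 'I_t, j = n + i).
Proof.
move=> lt_j; case: (ltnP j n) => hj; first by left; exists (Ordinal hj).
have lt_jt : j - n < t by lia.
by right; exists (Ordinal lt_jt) => /=; lia.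
Qed.

Lemma nth_row_bitsU n t (A A' : {set 'I_n}) (B B' : {set 'I_t}) j : j < n + t ->
  nth false (row_bits (A :|: A') (B :|: B')) j =
  nth false (row_bits A B) j || nth false (row_bits A' B') j.
Proof.
move=> lt_j; case: (row_bits_index lt_j) => [[i ->]|[i ->]].
  by rewrite !nth_row_bitsl inE.
by rewrite !nth_row_bitsr inE.
Qed.

Definition table_size alpha n : nat := #|{: {P : {set 'I_n} | #|P| == alpha}}|.

Lemma all_size_table alpha n t (C : sct alpha n t) :
  all (fun s => size s == n + t)
    [seq bits_of_set (val P) ++ bits_of_set (C P)
    | P <- enum {: {P : {set 'I_n} | #|P| == alpha}}].
Proof. by apply/allP=> s /mapP[P _ ->]; rewrite size_cat !size_bits_of_set. Qed.

Lemma size_encode alpha n t (C : sct alpha n t) :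
  size (encode C) = n + t + 2 + table_size alpha n * (n + t).
Proof.
rewrite /encode size_cat /= size_cat /= !size_nseq.
rewrite (size_flatten_uniform (all_size_table C)) size_map -cardE.
rewrite -/(table_size _ _).
lia.
Qed.

Lemma nth_encode_row alpha n t (C : sct alpha n t)
    (q : 'I_(table_size alpha n)) j :
  j < n + t ->
  nth false (encode C) (n + t + 2 + q * (n + t) + j) =
  nth false (row_bits (val (enum_val q)) (C (enum_val q))) j.
Proof.
move=> lt_j; rewrite /encode nth_cat size_nseq ifN; last by lia.
rewrite (_ : _ - n = (t + 1 + q * (n + t) + j).+1) /=; last by lia.
rewrite nth_cat size_nseq ifN; last by lia.
rewrite (_ : _ - t = (q * (n + t) + j).+1) /=; last by lia.
rewrite (nth_flatten_uniform _ (all_size_table C)) //; last first.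
  by rewrite size_map -cardE.
rewrite (nth_map (enum_val q)) -?cardE //.
by rewrite -(enum_val_nth (enum_val q)).
Qed.

(** A tuple of positive size contains an element. This gives the positive row width that the table
    scan requires. *)
Lemma table_size_gt0 alpha n : 0 < alpha -> 0 < table_size alpha n -> 0 < n.
Proof.
move=> a0 /card_gt0P[P _]; apply: leq_trans a0 _.
by rewrite -(eqP (valP P)) -[leqRHS]card_ord max_card.
Qed.

(** * Simulation of the abstract algorithm by the program *)

(** Representation invariant linking memory to a state of [greedy_reach]: the input is intact, and
    the work area right behind it encodes the current sets. *)
Definition heap_holds alpha n t (C : sct alpha n t) (h : nat -> nat)
    (S : {set 'I_n}) (X : {set 'I_t}) : Prop :=
  (forall a, a < size (encode C) -> h a = nth false (encode C) a) /\
  (forall j, j < n + t -> h (size (encode C) + j) = nth false (row_bits S X) j).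

Lemma heap_holds_row alpha n t (C : sct alpha n t) h S X
    (q : 'I_(table_size alpha n)) j :
  heap_holds C h S X -> j < n + t ->
  h (n + t + 2 + q * (n + t) + j) =
  nth false (row_bits (val (enum_val q)) (C (enum_val q))) j.
Proof.
move=> [hin _] lt_j; rewrite hin ?nth_encode_row // size_encode.
have := ltn_ord q; nia.
Qed.

Lemma sum_mem_card (T : finType) (A : {set T}) :
  \sum_(i : T) (i \in A : nat) = #|A|.
Proof.
by rewrite -sum1_card [RHS]big_mkcond; apply: eq_bigr => i _; case: (i \in A).
Qed.

Lemma gain_row alpha n t (C : sct alpha n t) h S X
    (q : 'I_(table_size alpha n)) :
  heap_holds C h S X ->
  gain h (size (encode C)) n t (n + t + 2 + q * (n + t)) =
  #|C (enum_val q) :\: X|.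
Proof.
move=> hh; rewrite /gain -{1}[n]add0n big_addn addKn big_mkord -sum_mem_card.
apply: eq_bigr => i _; rewrite [i + n]addnC (heap_holds_row _ hh) ?ltn_add2l //.
rewrite hh.2 ?ltn_add2l // !nth_row_bitsr inE.
by do 2!case: (_ \in _).
Qed.

(** One machine round simulates one abstract round. The default best row corresponds to
    [GreedyStuck], a genuine row to [GreedyPick]; every tuple occurs as a row, so a maximum over
    rows is a maximum over tuples. *)
Lemma greedy_round alpha n t (C : sct alpha n t) i s S X :
  0 < alpha ->
  let N := size (encode C) in let M := table_size alpha n in
  reg s 0 = N -> reg s 1 = n -> reg s 2 = t ->
  greedy_reach C i S X -> heap_holds C (heap s) S X ->
  runs (Seq best_cmd merge_cmd) s (M * (22 * t + 29) + 14 + ((n + t) * 28 + 8))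
    (fun s' => agree_off (fun x => 4 <= x <= 8) s s' /\
       exists S' X', greedy_reach C i.+1 S' X' /\ heap_holds C (heap s') S' X').
Proof.
move=> a0 N M r0 r1 r2 hr hh; apply: runs_seq.
apply: runs_weaken (leqnn _) _
  (best_cmd_runs r0 r1 r2 (size_encode C) _); last first.
  by move=> /(table_size_gt0 a0) n0; rewrite addn_gt0 n0.
move=> s1 [h1 hbest off1].
have ptr : reg s1 5 = N \/ reg s1 5 + (n + t) <= N.
  case: hbest => [[->]|[q [lt_q -> _ _]]]; [by left | right].
  rewrite /N size_encode; move: lt_q; rewrite -/M; nia.
apply: runs_weaken (leqnn _) _
  (@merge_cmd_runs N n t (reg s1 5) s1 _ _ _ _ ptr) => //;
  try by rewrite off1.
move=> s2 [hin hwork off2]; rewrite h1 in hin hwork; split.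
  move=> x hx; rewrite off2 ?off1 //=; apply/eqP; lia.
case: hbest => [[-> none]|[q [lt_q e5 gt0 hmax]]] in hwork *.
  exists S, X; split.
    apply: GreedyStuck => // P; rewrite -setD_eq0 -cards_eq0.
    by rewrite -[P]enum_rankK -(gain_row _ hh) none.
  split=> [a lt_a|j lt_j]; first by rewrite hin ?hh.1.
  by rewrite hwork // subnn addn0 hh.2.
pose Q : 'I_M := Ordinal lt_q; pose P := enum_val Q.
have e5' : reg s1 5 = n + t + 2 + Q * (n + t) by [].
exists (val P :|: S), (C P :|: X); split.
  apply: GreedyPick => //; rewrite /P -(gain_row _ hh) -e5' //.
  by move=> P'; rewrite -[P']enum_rankK -(gain_row _ hh) hmax.
split=> [a lt_a|j lt_j]; first by rewrite hin ?hh.1.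
rewrite hwork // e5' (heap_holds_row _ hh) // hh.2 // nth_row_bitsU //.
by do 2!case: (nth _ _ _).
Qed.

(** Each of the [t] rounds scans [M] rows of [t] target bits, and [t] and [M] are at most the input
    length; hence the cubic bound, with a generous constant. *)
Lemma greedy_cmd_runs alpha n t (C : sct alpha n t) :
  0 < alpha ->
  runs greedy_cmd (initial (encode C)) (200 * size (encode C) ^ 3 + 200)
    (fun s => exists S X,
       greedy_reach C t S X /\ holds_output s (bits_of_set S)).
Proof.
move=> a0; set N := size (encode C); pose M := table_size alpha n.
have hN : N = n + t + 2 + M * (n + t) := size_encode C.
pose round := M * (22 * t + 29) + 14 + ((n + t) * 28 + 8).
apply: (@runs_le _ _
    ((n * 7 + t * 11 + 12) + ((t * (2 + (4 + round)) + 2) + (n * 14 + 8)))).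
  (* If the table is nonempty, its rows are too, so it has at least [M] bits. *)
  have M_le : M <= N.
    have := @table_size_gt0 alpha n a0; rewrite -/M; nia.
  have n_le : n + t <= N by lia.
  have N_ge : 2 <= N by lia.
  have le1 : M * (22 * t + 29) <= N * (22 * N + 29) by rewrite leq_mul //; lia.
  have le2 : round <= N * (22 * N + 29) + 28 * N + 22 by rewrite /round; lia.
  have le3 : t * (6 + round) <= N * (6 + (N * (22 * N + 29) + 28 * N + 22)).
    by rewrite leq_mul //; lia.
  rewrite !expnS expn0 muln1; nia.
have pre i : i < n -> nth false (encode C) i.
  by move=> lt_i; rewrite /encode nth_cat size_nseq lt_i nth_nseq lt_i.
have mid : nth false (encode C) n = false.
  by rewrite /encode nth_cat size_nseq ltnn subnn.
(* For [i = t] this is the closing 0; beyond it the table begins and nothing is claimed. *)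
have post i : nth false (encode C) (n.+1 + i) = (i < t) \/ t < i.
  rewrite /encode nth_cat size_nseq ifN; last by lia.
  rewrite (_ : _ - n = i.+1) /=; last by lia.
  rewrite nth_cat size_nseq; case: ltngtP => hi; [left|by right|left].
    by rewrite nth_nseq hi.
  by rewrite hi subnn.
apply: runs_seq.
apply: runs_weaken (leqnn _) _
  (@parse_cmd_runs n t (initial (encode C)) _ _ _ _ _ _) => //=.
- move=> s [r0 r1 r2 r3 hh].
  pose I i s' := [/\ reg s' 0 = N, reg s' 1 = n, reg s' 2 = t,
    reg s' 3 = t - i &
    exists S X, greedy_reach C i S X /\ heap_holds C (heap s') S X].
  apply: runs_seq.
  apply: runs_weaken (leqnn _) _ (@runs_for _ _ (4 + round) t I _ _ _ _).
  + move=> s1 [k0 k1 k2 k3 [S [X [hr hX]]]].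
    apply: runs_weaken (leqnn _) _ (copy_cmd_runs k0 k1 _); last by lia.
    move=> s2 [l0 l1]; exists S, X; split=> //.
    split; rewrite size_bits_of_set //.
    move=> a lt_a; rewrite l1 // hX.2 ?ltn_addr //.
    by rewrite -[a]/(val (Ordinal lt_a)) nth_row_bitsl nth_bits_of_set.
  + move=> i s1 lt_i [k0 k1 k2 k3 [S [X [hr hX]]]].
    split; first by rewrite /= k3; lia.
    apply: runs_seq; apply: runs_assign.
    apply: runs_weaken (leqnn _) _ 
      (@greedy_round _ _ _ C i (State _ (heap s1)) S X a0 _ _ _ hr hX) => //.
    move=> s2 [off hS]; split=> //; rewrite off //= /update /= ?k3 //; lia.
  + by move=> s1 [k0 k1 k2 k3 _]; rewrite /= k3 subnn.
  + split=> //; first by rewrite r3 subn0.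
    exists set0, set0; split; first exact: GreedyStart.
    rewrite hh; split=> //= j lt_j.
    (* The work area starts just past the input, where memory is initially 0, and so represents the
       empty sets. *)
    rewrite nth_default ?leq_addr //.
    by case: (row_bits_index lt_j) => [] [i ->];
      rewrite ?nth_row_bitsl ?nth_row_bitsr inE.
- by move=> i lt_i; rewrite pre.
- by rewrite mid.
- by move=> i lt_i; case: (post i) => [->|]; [rewrite lt_i | lia].
- by case: (post t) => [->|]; [rewrite ltnn | lia].
Qed.

(** * Real estimates and the approximation ratio *)

Local Open Scope ring_scope.
Import Order.TTheory GRing.Theory Num.Theory.

(** Follows from [ln (1 + x) <= x] at [x = - 2^-1]. It serves to absorb an additive constant into a
    multiple of [ln t]. *)
Lemma ln_ge_half (R : realType) (t : nat) : (1 < t)%N -> 2^-1 <= ln t%:R :> R.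
Proof.
move=> ht; apply: (@le_trans _ _ (ln 2)); last first.
  by rewrite ler_ln ?posrE ?ltr0n ?ler_nat //; lia.
have := @le_ln1Dx R (- 2^-1) ltac:(lra).
by rewrite (_ : 1 - 2^-1 = 2^-1) ?lnV ?posrE //; lra.
Qed.

(** By [1 - 1/m <= expR (- 1/m)], the hypothesis yields [1 <= t * expR (- g/m)]; compare
    exponents. *)
Lemma decay_rounds_le (R : realType) (m t g : nat) :
  (0 < m)%N -> (0 < t)%N -> (m ^ g <= t * m.-1 ^ g)%N ->
  g%:R <= m%:R * ln t%:R :> R.
Proof.
move=> m0 t0 h.
have m0R : 0 < m%:R :> R by rewrite ltr0n.
have t0R : 0 < t%:R :> R by rewrite ltr0n.
have hm : m.-1%:R <= m%:R * expR (- m%:R^-1) :> R.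
  rewrite -ler_pdivrMl //; apply: le_trans (expR_ge1Dx _).
  rewrite -subn1 natrB // mulrBr mulVf ?gt_eqF // mulr1; lra.
have : m%:R ^+ g <= t%:R * (m%:R * expR (- m%:R^-1)) ^+ g :> R.
  apply: (@le_trans _ _ (t%:R * m.-1%:R ^+ g)).
    by rewrite -!natrX -natrM ler_nat.
  by rewrite ler_pM2l // lerXn2r // nnegrE ?mulr_ge0 ?expR_ge0 ?ler0n.
rewrite exprMn mulrCA -[X in X <= _]mulr1 ler_pM2l ?exprn_gt0 //.
rewrite -expRM_natl -{1}(@lnK _ t%:R) ?posrE // -expRD -[leLHS]expR0 ler_expR.
rewrite mulrN subr_ge0 => h'.
by rewrite -ler_pdivrMl // mulrC.
Qed.

(** With [b] the inverse of [alpha], write [s] as the product of its powers with exponents [1 - b]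
    and [b]; bound the first by [s <= n] and the second by [s <= L * k ^+ alpha]. *)
Lemma geometric_mean_bound (R : realType) (alpha : nat) (s n k L : R) :
  (0 < alpha)%N -> 0 <= s <= n -> 0 <= k -> 0 <= L -> s <= L * k ^+ alpha ->
  s <= n `^ (1 - alpha%:R^-1) * L `^ alpha%:R^-1 * k.
Proof.
move=> a0 /andP[s0 sn] k0 L0 hs; set b := alpha%:R^-1.
have aR : 0 < alpha%:R :> R by rewrite ltr0n.
have b0 : 0 <= b by rewrite invr_ge0 ler0n.
have b1 : b <= 1 by rewrite invf_le1 // ler1n.
have E : (L * k ^+ alpha) `^ b = L `^ b * k.
  rewrite powRM ?exprn_ge0 // -powR_mulrn // -powRrM divff ?gt_eqF //.
  by rewrite powRr1.
(* Splitting the power is valid even for [s = 0], because the exponents add up to 1 and not to 0. *)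
rewrite -mulrA -E -[leLHS]powRr1 // -{1}(subrK b 1) powRD; last first.
  by rewrite subrK oner_eq0.
by rewrite ler_pM ?powR_ge0 // ge0_ler_powR ?nnegrE ?subr_ge0
  ?mulr_ge0 ?exprn_ge0 // (le_trans s0).
Qed.

(* With at most one target [ln t] is 0, so there the trivial ratio is used. *)
Definition sct_ratio (R : realType) (alpha n t : nat) : R :=
  if (t <= 1)%N then n%:R
  else (3 * alpha)%:R `^ alpha%:R^-1 *
       (n%:R `^ (1 - alpha%:R^-1) * ln t%:R `^ (alpha%:R^-1)).

Lemma greedy_reach_ratio (R : realType) alpha n t (C : sct alpha n t)
    (S0 S : {set 'I_n}) X :
  (0 < alpha)%N -> feasible C S0 -> greedy_reach C t S X ->
  #|S|%:R <= sct_ratio R alpha n t * #|S0|%:R.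
Proof.
move=> a0 hS0 hr; have Sn : (#|S| <= n)%N by rewrite -[leqRHS]card_ord max_card.
case: t C X hS0 hr => [|t] C X hS0 hr.
  (* Without targets there are no rounds, so the output is empty. *)
  by inversion hr; rewrite cards0 /sct_ratio mulr_ge0.
(* Some target exists, so [S0] contains a whole tuple and is nonempty; this makes the trivial ratio
   [n] valid for a single target. *)
have [P hP _] := (feasibleP C S0).1 hS0 ord0.
have k0 : (0 < #|S0|)%N.
  by apply: leq_trans (subset_leq_card hP); rewrite (eqP (valP P)).
rewrite /sct_ratio; case: (leqP t.+1 1) => [_|t1].
  by rewrite -natrM ler_nat; nia.
(* The constant [3 * alpha] is merged with the logarithm to play the role of [L] in
   [geometric_mean_bound]. *)
rewrite [X in _ <= X * _]mulrCA -powRM; last 2 first.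
- by rewrite ler0n.
- by rewrite ln_ge0 // ler1n.
apply: geometric_mean_bound => //; rewrite ?ler0n ?ler_nat ?Sn //.
  by rewrite mulr_ge0 ?ler0n ?ln_ge0 ?ler1n.
have [g [hS _ hg]] := greedy_reach_decay hS0 hr.
have L2 := @ln_ge_half R _ t1.
set L := ln _ in L2 *.
have hk : (1 <= #|S0| ^ alpha)%N by rewrite expn_gt0 k0.
have hkR : 1 <= (#|S0| ^ alpha)%:R :> R by rewrite ler1n.
(* There are at most [m * L + 1] picks, where [m] is at most [#|S0| ^ alpha]. As [L] is at least one
   half and that power at least 1, the extra 1 costs at most two more copies of [L * #|S0| ^ alpha];
   hence the 3. *)
suff gL : g%:R <= 3 * L * (#|S0| ^ alpha)%:R :> R.
  apply: (@le_trans _ _ (alpha * g)%:R); first by rewrite ler_nat.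
  rewrite -natrX !natrM -mulrA [3 * _]mulrC -mulrA ler_pM2l ?ltr0n //.
  by rewrite mulrA.
case: g hS hg => [|g] hS hg; first by rewrite !mulr_ge0 //; lra.
have [m0 hm] := hg isT.
have := @decay_rounds_le R _ t.+1 g m0 isT hm; rewrite -/L => le_g.
have le_m : (tuples_in alpha S0)%:R <= (#|S0| ^ alpha)%:R :> R.
  by rewrite ler_nat tuples_in_le.
by rewrite -natr1; nra.
Qed.

Theorem theorem7 (R : realType) (alpha : nat) (halpha : (1 < alpha)%N) :
  exists (p : cmd) (r : nat -> nat -> R),
    [/\ polytime_on (sct_encoding alpha) p,
        sct_approximates alpha p r &
        exists K : R, forall n t : nat, (1 < t)%N ->
          r n t <= K * (n%:R `^ (1 - alpha%:R^-1) * ln t%:R `^ (alpha%:R^-1))].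
Proof.
have a0 : (0 < alpha)%N by apply: ltnW.
exists greedy_cmd, (sct_ratio R alpha); split.
- exists 200, 3 => _ [n [t [C ->]]].
  by have [k [s [E hk _]]] := greedy_cmd_runs C a0; exists k, s.
- move=> n t C [S0 hS0].
  have [k [s [E _ [S [X [hr out]]]]]] := greedy_cmd_runs C a0.
  exists S; split; first by exists k, s.
    exact: greedy_reach_feasible hS0 hr.
  by move=> Sopt [hopt _]; apply: (greedy_reach_ratio _ a0 hopt hr).
- exists ((3 * alpha)%:R `^ alpha%:R^-1) => n t t1.
  by rewrite /sct_ratio leqNgt t1.
Qed.
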